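(* Let $d\ge 2$, $m\ge 1$, $n=d+m$. Let $\mathcal{L}\subset\mathbb{R}^n$ be a lattice, let $\mathcal{W}\subset\mathbb{R}^m$ be a window which is star-shaped with respect to the origin, and suppose the cut-and-project set $\Lambda=\Lambda(\mathcal{W},\mathcal{L})\subset\mathbb{R}^d$ is irreducible. Then $\Lambda_{\mathrm{vis}}$ has arbitrarily large holes; that is, for every $R>0$ there is a ball $B\subset\mathbb{R}^d$ of radius $R$ with $B\cap\Lambda_{\mathrm{vis}}=\varnothing$.
   Context: Write $\mathbb{R}^n=\mathbb{R}^d\oplus\mathbb{R}^m$ with projections $\pi_{\mathrm{phys}}:\mathbb{R}^n\to\mathbb{R}^d$ and $\pi_{\mathrm{int}}:\mathbb{R}^n\to\mathbb{R}^m$. A lattice in $\mathbb{R}^n$ is a set $g\mathbb{Z}^n$ with $g\in\mathrm{GL}(n,\mathbb{R})$. A window is a subset $\mathcal{W}\subset\mathbb{R}^m$ with non-empty interior which is Jordan measurable (bounded, with boundary of zero Lebesgue measure). $\mathcal{W}$ is star-shaped with respect to the origin if $tw\in\mathcal{W}$ for all $w\in\mathcal{W}$, $t\in[0,1]$. The cut-and-project set is $\Lambda(\mathcal{W},\mathcal{L})=\{\pi_{\mathrm{phys}}(y): y\in\mathcal{L},\ \pi_{\mathrm{int}}(y)\in\mathcal{W}\}$. It is called irreducible if $\pi_{\mathrm{int}}(\mathcal{L})$ is dense in $\mathbb{R}^m$ and $\pi_{\mathrm{phys}}|_{\mathcal{L}}$ is injective. For a locally finite set $\mathcal{P}\subset\mathbb{R}^d$,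 $\mathcal{P}_{\mathrm{vis}}=\{y\in\mathcal{P}\smallsetminus\{0\}: ty\notin\mathcal{P}\ \text{for all } t\in(0,1)\}$ is the set of points visible from the origin. *)

(* Defs.v *)
From HB Require Import structures.
From mathcomp Require Import all_boot all_order all_algebra.
From mathcomp Require Import all_classical all_reals all_analysis.
Import Order.TTheory GRing.Theory Num.Theory.
Import numFieldNormedType.Exports.

Set Implicit Arguments.
Unset Strict Implicit.
Unset Printing Implicit Defensive.

Local Open Scope classical_set_scope.
Local Open Scope ring_scope.

(* R^k is 'rV[R]_k. The library norm on it is the sup norm, which gives the
   usual topology and bounded sets; balls are Euclidean, see [euclidean_ball]. *)

Definition pi_phys (R : realType) (d m : nat) (y : 'rV[R]_(d + m)) : 'rV[R]_d :=
  lsubmx y.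

Definition pi_int (R : realType) (d m : nat) (y : 'rV[R]_(d + m)) : 'rV[R]_m :=
  rsubmx y.

(* Vectors being rows, the invertible matrix acts on the right: the rows of g
   are a basis of the lattice. *)
Definition is_lattice (R : realType) (n : nat) (L : set 'rV[R]_n) : Prop :=
  exists2 g : 'M[R]_n, g \in unitmx &
    L = [set map_mx intr z *m g | z in [set: 'rV[int]_n]].

Definition box (R : realType) (m : nat) (a b : 'rV[R]_m) : set 'rV[R]_m :=
  [set x | forall i, a ord0 i < x ord0 i <= b ord0 i].

Definition box_volume (R : realType) (m : nat) (a b : 'rV[R]_m) : R :=
  \prod_(i < m) Num.max 0 (b ord0 i - a ord0 i).

(* m-dimensional Lebesgue outer measure, built from half-open boxes as the
   library's one-dimensional [lebesgue_measure] is from half-open intervals. *)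
Definition lebesgue_outer (R : realType) (m : nat) (A : set 'rV[R]_m) : \bar R :=
  ereal_inf [set (\sum_(0 <= k <oo) (box_volume (ab k).1 (ab k).2)%:E)%E
            | ab in [set ab : nat -> 'rV[R]_m * 'rV[R]_m |
                      A `<=` \bigcup_k box (ab k).1 (ab k).2]].

Definition boundary (T : topologicalType) (A : set T) : set T :=
  closure A `\` interior A.

Definition jordan_measurable (R : realType) (m : nat) (A : set 'rV[R]_m) : Prop :=
  bounded_set A /\ lebesgue_outer (boundary A) = 0%E.

Definition is_window (R : realType) (m : nat) (W : set 'rV[R]_m) : Prop :=
  interior W !=set0 /\ jordan_measurable W.

Definition star_shaped (R : realType) (m : nat) (W : set 'rV[R]_m) : Prop :=
  forall (w : 'rV[R]_m) (t : R), W w -> 0 <= t <= 1 -> W (t *: w).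

Definition cut_and_project (R : realType) (d m : nat)
    (W : set 'rV[R]_m) (L : set 'rV[R]_(d + m)) : set 'rV[R]_d :=
  [set pi_phys y | y in [set y | L y /\ W (pi_int y)]].

(* Irreducibility of the set cut_and_project W L involves only L. *)
Definition irreducible (R : realType) (d m : nat) (L : set 'rV[R]_(d + m)) : Prop :=
  dense (@pi_int R d m @` L) /\ set_inj L (@pi_phys R d m).

Definition visible (R : realType) (d : nat) (P : set 'rV[R]_d) : set 'rV[R]_d :=
  [set y | P y /\ y <> 0 /\ forall t : R, 0 < t < 1 -> ~ P (t *: y)].

Definition euclidean_ball (R : realType) (d : nat) (c : 'rV[R]_d) (r : R) :
    set 'rV[R]_d :=
  [set x | Num.sqrt (\sum_(i < d) (x ord0 i - c ord0 i) ^+ 2) < r].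

(* Main.v *)
Require Import Defs.
From mathcomp Require Import all_boot all_order all_algebra.
From mathcomp Require Import all_classical all_reals all_analysis.
From mathcomp Require Import zify.
Import Order.TTheory GRing.Theory Num.Theory.
Import numFieldNormedType.Exports.

Set Implicit Arguments.
Unset Strict Implicit.

Local Open Scope classical_set_scope.
Local Open Scope ring_scope.

(** A lattice point with internal part in the window that is p times another
    lattice point, p at least 2, never projects to a visible point: dividing by
    p stays in the lattice, and it stays in the window because the window is
    star-shaped ([proper_multiple_not_visible]). It is therefore enough to find a
    ball B(c, r) such that every lattice point in B(c, r) x W is such a proper
    multiple.

    Take c = pi_phys s with s a lattice point and |pi_int s| < 1. The
    differences x - s, for x a lattice point in B(c, r) x W, are then lattice
    points of norm at most max r (K + 1), where K bounds W. They thus range over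
    a finite set F that does not depend on s
    ([lattice_points_of_bounded_norm_finite]). The Chinese remainder idea gives
    a lattice point a and an integer N > 0 such that each a + f, f in F, is
    divisible by some p > 1 that divides N
    ([translate_into_proper_multiples]). Every s in the coset a + N L then makes
    all the s + f proper multiples, and density of pi_int L, applied at the
    scale 1 / N, provides such an s with |pi_int s| < 1
    ([small_internal_part_in_coset]). *)

(** The lattice is handled through integer coordinates, where divisibility is
    visible. *)
Definition lattice_point (R : realType) (n : nat) (g : 'M[R]_n)
  (z : 'rV[int]_n) : 'rV[R]_n := map_mx intr z *m g.

Lemma lattice_pointD (R : realType) (n : nat) (g : 'M[R]_n) (y z : 'rV[int]_n) :
  lattice_point g (y + z) = lattice_point g y + lattice_point g z.
Proof. by rewrite /lattice_point raddfD mulmxDl. Qed.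

Lemma lattice_pointB (R : realType) (n : nat) (g : 'M[R]_n) (y z : 'rV[int]_n) :
  lattice_point g (y - z) = lattice_point g y - lattice_point g z.
Proof. by rewrite /lattice_point raddfB mulmxBl. Qed.

Lemma lattice_pointMn (R : realType) (n : nat) (g : 'M[R]_n) (z : 'rV[int]_n)
    (k : nat) :
  lattice_point g (z *+ k) = lattice_point g z *+ k.
Proof. by rewrite /lattice_point raddfMn -[LHS]/(mulmxr g _) raddfMn. Qed.

Lemma lattice_point_in (R : realType) (n : nat) (g : 'M[R]_n) (z : 'rV[int]_n) :
  [set map_mx intr y *m g | y in [set: 'rV[int]_n]] (lattice_point g z).
Proof. by exists z. Qed.

Lemma ler_norm_entry (R : realType) (n : nat) (x : 'rV[R]_n) (j : 'I_n) :
  `|x ord0 j| <= `|x|.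
Proof.
rewrite -[`|x|]/(mx_norm x) mx_normrE.
exact: (le_bigmax _ (fun ij : 'I_1 * 'I_n => `|x ij.1 ij.2|) (ord0, j)).
Qed.

Lemma ler_norm_row_block (R : realType) (d m : nat) (u : 'rV[R]_(d + m)) (C : R) :
  (forall i, `|pi_phys u ord0 i| <= C) -> (forall i, `|pi_int u ord0 i| <= C) ->
  forall j, `|u ord0 j| <= C.
Proof.
move=> hp hi j; case: (split_ordP j) => i ->.
- by have := hp i; rewrite mxE.
- by have := hi i; rewrite mxE.
Qed.

Lemma euclidean_ball_entry (R : realType) (d : nat) (c x : 'rV[R]_d) (r : R) :
  euclidean_ball c r x -> forall i, `|(x - c) ord0 i| <= r.
Proof.
move=> hx i; apply: le_trans (ltW hx); rewrite !mxE -sqrtr_sqr.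
apply: ler_wsqrtr; rewrite (bigD1 i) //= lerDl.
by apply: sumr_ge0 => k _; exact: sqr_ge0.
Qed.

Lemma int_box_finite (n M : nat) :
  exists s : seq 'rV[int]_n,
    forall z : 'rV[int]_n, (forall i, (`|z ord0 i| <= M)%N) -> z \in s.
Proof.
exists [seq \row_i ((f i : nat)%:Z - M%:Z) | f : {ffun 'I_n -> 'I_(2 * M).+1}].
move=> z hz; apply/mapP.
exists [ffun i => inord (absz (z ord0 i + M%:Z))]; first by rewrite mem_enum.
apply/rowP=> i; rewrite -[LHS]/(z ord0 i) mxE ffunE inordK; have := hz i; lia.
Qed.

(** The coordinates of a point of norm at most C are bounded through the
    inverse of g, and there are finitely many integers below a bound. *)
Lemma lattice_points_of_bounded_norm_finite (R : realType) (n : nat)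
    (g : 'M[R]_n) (hg : g \in unitmx) (C : R) :
  exists s : seq 'rV[int]_n,
    forall z, (forall j, `|lattice_point g z ord0 j| <= C) -> z \in s.
Proof.
pose S : R := \sum_i \sum_j C * `|invmx g j i|.
have [s hs] := int_box_finite n (Num.Def.archi_bound S).
exists s => z hz; apply: hs => i.
have C0 (k : 'I_n) : 0 <= C by apply: le_trans (hz k).
have zE : (z ord0 i)%:~R = \sum_j lattice_point g z ord0 j * invmx g j i :> R.
  by have /rowP/(_ i) := mulmxK hg (map_mx intr z); rewrite [RHS]mxE mxE => <-.
rewrite -(ler_nat R) natr_absz intr_norm zE.
apply: le_trans (ltW (unstable.ltr_bound S)).
apply: le_trans (ler_norm_sum _ _ _) _.
rewrite [leRHS](bigD1 i) //=; apply: ler_wpDr.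
- by apply: sumr_ge0 => k _; apply: sumr_ge0 => j _; rewrite mulr_ge0 // (C0 j).
- by apply: ler_sum => j _; rewrite normrM ler_wpM2r.
Qed.

(** A Chinese remainder theorem in which the moduli are built on the way: N + 1
    is coprime to the product N of the moduli used so far. Requiring p to divide
    N lets the shift vary in the whole coset of a modulo N. *)
Lemma translate_into_proper_multiples (V : zmodType) (s : seq V) :
  exists (a : V) (N : nat), (0 < N)%N /\
    forall f, f \in s ->
      exists p : nat, [/\ (1 < p)%N, (p %| N)%N & exists b, a + f = b *+ p].
Proof.
elim: s => [|f s [a [N [N0 hs]]]]; first by exists 0, 1%N.
(* The new shift is a modulo N, and it is - f modulo N + 1. *)
exists (a + (a + f) *+ N), (N * N.+1)%N; split; first by rewrite muln_gt0 N0.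
move=> h; rewrite inE => /predU1P[->|/hs[p [p1 pN [b hb]]]].
- exists N.+1; split; rewrite ?dvdn_mull //.
  by exists (a + f); rewrite mulrS addrAC.
- exists p; split; rewrite ?dvdn_mulr //.
  exists (b + (a + f) *+ (N %/ p)).
  by rewrite [RHS]mulrnDl -mulrnA divnK // addrAC hb.
Qed.

(** With v the internal part of a, multiplication by N turns a point of pi_int L
    within 1 / N of - v / N into a point of N pi_int L within 1 of - v. *)
Lemma small_internal_part_in_coset (R : realType) (d m : nat)
    (g : 'M[R]_(d + m)) (a : 'rV[int]_(d + m)) (N : nat) (N0 : (0 < N)%N) :
  dense (@pi_int R d m @` [set map_mx intr z *m g | z in [set: 'rV[int]_(d + m)]]) ->
  exists z, `|pi_int (lattice_point g (a + z *+ N))| < 1.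
Proof.
move=> hd; set v := pi_int (lattice_point g a).
have NR0 : 0 < N%:R :> R by rewrite ltr0n.
have Ni0 : 0 < N%:R^-1 :> R by rewrite invr_gt0.
have [|x []] := hd (ball (- (N%:R^-1 *: v)) N%:R^-1) _ (ball_open _ _).
  by exists (- (N%:R^-1 *: v)); apply: ballxx.
rewrite -ball_normE /= => hx [y [z _ zE] yE]; exists z.
rewrite lattice_pointD lattice_pointMn.
have -> : pi_int (lattice_point g a + lattice_point g z *+ N) = v + x *+ N.
  by rewrite -yE -zE /pi_int raddfD raddfMn.
have -> : v + x *+ N = - N%:R *: (- (N%:R^-1 *: v) - x).
  by rewrite scalerBr scalerN !scaleNr opprK scalerA mulfV ?gt_eqF // scale1r opprK
    scaler_nat.
by rewrite normrZ normrN normr_nat -(@ltr_pM2l _ N%:R^-1) // mulrA mulVf ?gt_eqF //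
  mul1r mulr1.
Qed.

(** Star-shapedness is what keeps the quotient by p in the window. *)
Lemma proper_multiple_not_visible (R : realType) (d m : nat)
    (L : set 'rV[R]_(d + m)) (W : set 'rV[R]_m) (hstar : star_shaped W)
    (b : 'rV[R]_(d + m)) (p : nat) :
  (1 < p)%N -> L b -> W (pi_int (b *+ p)) ->
  ~ visible (cut_and_project W L) (pi_phys (b *+ p)).
Proof.
move=> p1 Lb Wb [_ [_ /(_ p%:R^-1)]].
have pR1 : 1 < p%:R :> R by rewrite ltr1n.
have pR0 : 0 < p%:R :> R by apply: lt_trans pR1.
have divp k (x : 'rV[R]_k) : p%:R^-1 *: (x *+ p) = x.
  by rewrite -[x *+ p]scaler_nat scalerA mulVf ?gt_eqF // scale1r.
case; first by rewrite invr_gt0 pR0 invf_lt1.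
exists b; last by rewrite /pi_phys raddfMn divp.
split=> //; have := hstar _ p%:R^-1 Wb; rewrite /pi_int raddfMn divp; apply.
by rewrite invr_ge0 ltW //= invf_le1 // ltW.
Qed.

Unset Implicit Arguments.
Set Strict Implicit.

Theorem theorem1p1 (R : realType) (d m : nat) (hd : (2 <= d)%N) (hm : (1 <= m)%N)
    (L : set 'rV[R]_(d + m)) (hL : is_lattice L)
    (W : set 'rV[R]_m) (hW : is_window W) (hstar : star_shaped W)
    (hirr : irreducible L) :
  forall r : R, 0 < r ->
    exists c : 'rV[R]_d,
      euclidean_ball c r `&` visible (cut_and_project W L) = set0.
Proof.
move=> r r0; case: hL hirr => g hg -> [hdense _].
have [K hK] : exists K : R, forall w, W w -> `|w| <= K.
  by case: hW => _ [bndW _]; have [K hK] := filter_ex (F := +oo) bndW; exists K.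
have [F hF] := lattice_points_of_bounded_norm_finite hg (Num.max r (K + 1)).
have [a [N [N0 haN]]] := translate_into_proper_multiples F.
have [z] := small_internal_part_in_coset a N0 hdense.
set s := a + z *+ N => hs.
exists (pi_phys (lattice_point g s)); apply/seteqP; split=> // y [hball hvis].
case: (hvis) => -[_ [[w _ <-] Ww] yE] _.
rewrite -/(lattice_point g w) in Ww yE.
have wF : w - s \in F.
  apply: hF => j; rewrite lattice_pointB.
  apply: ler_norm_row_block => i.
  - have := euclidean_ball_entry hball i.
    by rewrite -yE /pi_phys raddfB le_max => ->.
  - rewrite le_max; apply/orP; right; apply: le_trans (ler_norm_entry _ _) _.
    rewrite /pi_int raddfB; apply: le_trans (ler_normB _ _) _.
    by apply: lerD; [exact: hK | exact: ltW].
have [p [p1 pN [b hb]]] := haN _ wF.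
have wE : w = (b + z *+ (N %/ p)) *+ p.
  by rewrite mulrnDl -mulrnA divnK // -hb /s addrAC addrC subrK.
rewrite wE lattice_pointMn in Ww yE.
apply: (@proper_multiple_not_visible R d m _ _ hstar _ _ p1 _ Ww);
  last by rewrite yE; exact: hvis.
exact: lattice_point_in.
Qed.
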